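(* Let $S_{\boldsymbol{\lambda}}$ be the weighted shift, on the directed tree $\mathfrak{T}=(V,E)$ of sequences, with the weights $\boldsymbol{\lambda}$, all as described in the context. The operator $S_{\boldsymbol{\lambda}}$ is hyponormal.
   Context: Let $\mathbb{Z}_+=\{0,1,2,\ldots\}$. For a sequence $v:\mathbb{Z}\to\mathbb{Z}_+\cup\{-1\}$ put $m(v)=\inf\{n\in\mathbb{Z}:v_n\neq0\}-2$ and $M(v)=\sup\{n\in\mathbb{Z}:v_n>-1\}$. Let $$V=\{v:\mathbb{Z}\to\mathbb{Z}_+\cup\{-1\}\;:\;m(v)>-\infty,\ M(v)<\infty,\ v_n>-1\text{ for }n\le M(v)\},$$ $$E=\{(u,v)\in V\times V\;:\;M(v)=M(u)+1\text{ and }u_n=v_n\text{ for }n\le M(u)\}.$$ Then $\mathfrak{T}=(V,E)$ is a rootless directed tree in which every vertex has countably infinitely many children. For $u\in V$, $\mathrm{Chi}(u)=\{v\in V:(u,v)\in E\}$, and $\mathrm{par}(v)$ is the unique $u$ with $(u,v)\in E$. Define weights $\boldsymbol{\lambda}=\{\lambda_v\}_{v\in V}$ by $$\lambda_v=\frac{2^{v_{m(v)}+\ldots+v_{M(v)-1}}}{v_{M(v)}+1},\qquad v\in V.$$ $\ell^2(V)$ is the complex Hilbert space of square-summable functions $f:V\to\mathbb{C}$. The weighted shift $S_{\boldsymbol{\lambda}}$ is the operator in $\ell^2(V)$ with domain $$\mathcal{D}(S_{\boldsymbol{\lambda}})=\Big\{f\in\ell^2(V):\sum_{u\in V}\Big(\sum_{v\in\mathrm{Chi}(u)}|\lambda_v|^2\Big)|f(u)|^2<\infty\Big\}$$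 (with $\infty\cdot0=0$) and $(S_{\boldsymbol{\lambda}}f)(v)=\lambda_vf(\mathrm{par}(v))$ for $v\in V$. A densely defined operator $T$ is hyponormal if $\mathcal{D}(T)\subset\mathcal{D}(T^* )$ and $\|Tf\|\ge\|T^*f\|$ for every $f\in\mathcal{D}(T)$. *)

(* Defs.v *)
From mathcomp Require Import all_boot all_order all_algebra.
From mathcomp Require Import complex.
From mathcomp Require Import all_classical all_reals all_analysis.

Set Implicit Arguments.
Unset Strict Implicit.
Unset Printing Implicit Defensive.

Import Order.TTheory GRing.Theory Num.Theory.
Import Normc.
Local Open Scope classical_set_scope.
Local Open Scope ring_scope.
Local Open Scope complex_scope.

Section ell2.
Context (R : realType) (T : choiceType).
Implicit Types (f g h : T -> R[i]).

Definition sqsum f : \bar R := \esum_(x in [set: T]) (normc (f x) ^+ 2)%:E.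

Definition ell2 : set (T -> R[i]) := [set f | (sqsum f < +oo)%E].

Definition ell2norm f : R := Num.sqrt (fine (sqsum f)).

(* Unordered sums of absolutely summable families; junk on other families. *)
Definition rsum (a : T -> R) : R :=
  fine (\esum_(x in [set: T]) (a^\+ x)%:E) -
  fine (\esum_(x in [set: T]) (a^\- x)%:E).

Definition csum (a : T -> R[i]) : R[i] :=
  rsum (fun x => complex.Re (a x)) +i* rsum (fun x => complex.Im (a x)).

Definition ell2dot f g : R[i] := csum (fun x => f x * (g x)^*).

(* A partially defined map; its values outside of [dom] are irrelevant. *)
Record partial_map := PartialMap {
  dom : set (T -> R[i]);
  app :> (T -> R[i]) -> (T -> R[i]) }.

Definition linear_operator (A : partial_map) :=
  [/\ dom A `<=` ell2,
      dom A (fun=> 0),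
      forall (c : R[i]) f g, dom A f -> dom A g ->
        dom A (fun x => c * f x + g x),
      forall f, dom A f -> ell2 (A f)
    & forall (c : R[i]) f g, dom A f -> dom A g ->
        A (fun x => c * f x + g x) = (fun x => c * A f x + A g x)].

Definition densely_defined (A : partial_map) :=
  forall f, ell2 f -> forall e : R, 0 < e ->
    exists2 g, dom A g & ell2norm (fun x => f x - g x) < e.

Definition adjoint_value (A : partial_map) g h :=
  ell2 h /\ forall f, dom A f -> ell2dot (A f) g = ell2dot f h.

(* For a densely defined [A] the value [h] below is unique. *)
Definition adjoint (A : partial_map) : partial_map :=
  PartialMap [set g | ell2 g /\ exists h, adjoint_value A g h]
             (fun g => xget (fun=> 0) [set h | adjoint_value A g h]).

Definition hyponormal (A : partial_map) :=
  [/\ linear_operator A,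
      densely_defined A,
      dom A `<=` dom (adjoint A)
    & forall f, dom A f -> ell2norm (adjoint A f) <= ell2norm (A f)].

End ell2.

Section weighted_shift.
Context (R : realType) (T : choiceType) (E : T -> T -> Prop) (w : T -> R[i]).

Definition Chi (u : T) : set T := [set v | E u v].

(* The default value [v] is taken only at roots. *)
Definition par (v : T) : T := xget v [set u | E u v].

(* In [\bar R] one has [+oo * 0 = 0]. *)
Definition weighted_shift : partial_map R T :=
  PartialMap
    [set f | ell2 f /\
      ((\esum_(u in [set: T])
          ((\esum_(v in Chi u) (normc (w v) ^+ 2)%:E) *
           (normc (f u) ^+ 2)%:E)) < +oo)%E]
    (fun f v => w v * f (par v)).

End weighted_shift.

(* Infima and suprema of sets of integers are taken in [\bar int], with
   inf set0 = +oo and sup set0 = -oo. *)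
Definition m (v : int -> int) : \bar int :=
  (infimum +oo [set n%:E | n in [set n : int | v n != 0%R]] - 2%:E)%E.

Definition M (v : int -> int) : \bar int :=
  supremum -oo%E [set n%:E%E | n in [set n : int | -1 < v n]].

Definition admissible : set (int -> int) :=
  [set v | [/\ forall n, -1 <= v n,
               (-oo < m v)%E,
               (M v < +oo)%E
             & forall n : int, (n%:E <= M v)%E -> -1 < v n]].

Definition V : choiceType := set_type admissible.

Definition seq_of (v : V) : int -> int := \val v.

Definition E (u v : V) : Prop :=
  M (seq_of v) = (M (seq_of u) + 1%:E)%E /\
  forall n : int, (n%:E <= M (seq_of u))%E -> seq_of u n = seq_of v n.

(* For [v : V] both [m (seq_of v)] and [M (seq_of v)] are finite. *)
Definition weight (R : realType) (v : V) : R[i] :=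
  let s := seq_of v in
  2 ^ (\sum_(n \in [set n : int | (m s <= n%:E <= M s - 1%:E)%E]) s n) /
  (s (fine (M s)) + 1)%:~R.

(* Main.v *)
Require Import Defs.
From mathcomp Require Import all_boot all_order all_algebra.
From mathcomp Require Import complex.
From mathcomp Require Import all_classical all_reals all_analysis.
From mathcomp Require Import ring lra zify.

(** Write [S] for the weighted shift and [b u] for the squared norm of the image
    under [S] of the basis vector at [u], i.e. the sum of the squared moduli of
    the weights of the children of [u].  Every vertex has a parent, so the
    vertices are partitioned into sibling families, and summing over families
    first gives [|S f|^2 = sum_u b u |f u|^2].  Moving [S] to the other side of
    the scalar product in the same way, the adjoint acts on the domain of [S] by
    [(S* f) u = sum_(v child of u) conj (w v) f v].

    If [sum_(v child of u) |w v|^2 / b v <= 1] for every [u], then the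
    Cauchy-Schwarz inequality in each family gives
    [|(S* f) u|^2 <= sum_(v child of u) b v |f v|^2]; summing over [u] yields
    [|S* f| <= |S f|], which is hyponormality ([shift_hyponormal]).  As the
    scalar product is built from unordered sums of positive and negative parts,
    the argument rests on the linearity of these sums and on their regrouping
    along the parent map ([csum_by_fibre]).

    For the tree of sequences, let [total u] be the sum of the entries of [u] up
    to its top index.  The children of [u] are its extensions by one entry
    [k = 0, 1, 2, ...]; the [k]-th child has weight [2 ^ total u / (k + 1)] and
    total [total u + k] ([weight_child], [total_child]).  Hence
    [b u = 4 ^ total u * zeta2] with [zeta2 = sum_k 1 / (k + 1)^2], and
    [|w v|^2 / b v = 4 ^ (- k) / ((k + 1)^2 zeta2)] at the [k]-th child, so these
    ratios sum to at most [1]. *)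

Set Implicit Arguments.
Unset Strict Implicit.
Unset Printing Implicit Defensive.

Import Order.TTheory GRing.Theory Num.Theory.
Import Normc.
Local Open Scope classical_set_scope.
Local Open Scope ring_scope.
Local Open Scope complex_scope.

(** * Unordered sums of real families *)

Section real_sums.
Context (R : realType) (T : choiceType).
Implicit Types (a b p q : T -> R) (c : R).

Definition tsum a : \bar R := \esum_(x in [set: T]) (a x)%:E.

Lemma tsum_ge0 a : (forall x, 0 <= a x) -> (0 <= tsum a)%E.
Proof. by move=> a0; apply: esum_ge0 => x _; rewrite lee_fin. Qed.

Lemma le_tsum a b : (forall x, a x <= b x) -> (tsum a <= tsum b)%E.
Proof. by move=> ab; apply: le_esum => x _; rewrite lee_fin. Qed.

Lemma tsumD a b : (forall x, 0 <= a x) -> (forall x, 0 <= b x) ->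
  tsum (fun x => a x + b x) = (tsum a + tsum b)%E.
Proof.
move=> a0 b0; rewrite /tsum -esumD//; try by move=> x _; rewrite lee_fin.
Qed.

Lemma fin_tsum a : (forall x, 0 <= a x) -> (tsum a < +oo)%E ->
  tsum a \is a fin_num.
Proof. by move=> a0 aoo; rewrite ge0_fin_numE// tsum_ge0. Qed.

(** One inequality holds for finite partial sums, hence for suprema; the other
    one is the same inequality applied to the inverse factor. *)
Lemma tsumZ c a : 0 <= c -> (forall x, 0 <= a x) ->
  tsum (fun x => c * a x) = (c%:E * tsum a)%E.
Proof.
have half k f : 0 < k -> (forall x, 0 <= f x) ->
    (tsum (fun x => k * f x)%R <= k%:E * tsum f)%E.
  move=> k0 f0; apply: ge_ereal_sup => _ [X [finX XT]] <-.
  under eq_fsbigr do rewrite EFinM.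
  rewrite -ge0_mule_fsumr; last by move=> i; rewrite lee_fin.
  rewrite lee_pmul2l//; apply: ereal_sup_ubound; by exists X.
rewrite le_eqVlt => /predU1P[<- a0|c0 a0].
  by rewrite mul0e; apply: esum1 => x _; rewrite mul0r.
apply/eqP; rewrite eq_le half//= -lee_pdivlMl//.
have ca0 x : 0 <= c * a x by rewrite mulr_ge0// ltW.
apply: le_trans (half _ _ _ ca0); last by rewrite invr_gt0.
by apply: le_tsum => x; rewrite mulKf ?gt_eqF.
Qed.

Definition abs_summable a := (tsum (fun x => `|a x|%R) < +oo)%E.

Lemma le_abs_summable a b : (forall x, `|a x| <= b x) -> (tsum b < +oo)%E ->
  abs_summable a.
Proof. by move=> ab; apply: le_lt_trans; exact: le_tsum. Qed.

Lemma abs_summable_pos a : abs_summable a -> (tsum (a^\+)%R < +oo)%E.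
Proof.
apply: le_lt_trans; apply: le_tsum => x.
by rewrite /funrpos ge_max ler_norm normr_ge0.
Qed.

Lemma abs_summable_neg a : abs_summable a -> (tsum (a^\-)%R < +oo)%E.
Proof.
apply: le_lt_trans; apply: le_tsum => x.
by rewrite /funrneg ge_max -normrN ler_norm normr_ge0.
Qed.

Lemma funr_pos_neg a x : a x = a^\+ x - a^\- x.
Proof. by have /(congr1 (@^~ x)) := funrposBneg a. Qed.

Lemma rsumE a : rsum a = fine (tsum a^\+) - fine (tsum a^\-).
Proof. by []. Qed.

(** The difference does not depend on the decomposition chosen, because
    [p + a^\-] and [q + a^\+] are the same nonnegative family.  Linearity and
    regrouping of signed sums are reduced to nonnegative ones through this. *)
Lemma rsum_diff a p q : (forall x, 0 <= p x) -> (forall x, 0 <= q x) ->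
  (tsum p < +oo)%E -> (tsum q < +oo)%E -> (forall x, a x = p x - q x) ->
  rsum a = fine (tsum p) - fine (tsum q).
Proof.
move=> p0 q0 poo qoo apq.
have aoo : abs_summable a.
  apply: (@le_abs_summable _ (fun x => p x + q x)).
    move=> x; rewrite apq (le_trans (ler_normB _ _))// !ger0_norm//.
  by rewrite tsumD// lte_add_pinfty.
have := abs_summable_neg aoo; have := abs_summable_pos aoo => aPoo aNoo.
have : (tsum p + tsum (a^\-)%R = tsum q + tsum (a^\+)%R)%E.
  rewrite -!tsumD//; try (by move=> x; rewrite ?funrpos_ge0 ?funrneg_ge0).
  congr tsum; apply/funext => x; have := apq x; rewrite (funr_pos_neg a x); lra.
rewrite rsumE.
move: (fin_tsum p0 poo) (fin_tsum q0 qoo) (fin_tsum (funrpos_ge0 a) aPoo)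
  (fin_tsum (funrneg_ge0 a) aNoo) => /fineK<- /fineK<- /fineK<- /fineK<- /=.
by rewrite -!EFinD => -[]; lra.
Qed.

Lemma rsum_ge0E a : (forall x, 0 <= a x) -> (tsum a < +oo)%E ->
  rsum a = fine (tsum a).
Proof.
move=> a0 aoo; rewrite (@rsum_diff a a (fun=> 0))//.
- by rewrite [tsum (fun=> 0)]esum1//= subr0.
- by rewrite [tsum (fun=> 0)]esum1.
- by move=> x; rewrite subr0.
Qed.

Lemma abs_summableD a b : abs_summable a -> abs_summable b ->
  abs_summable (fun x => a x + b x).
Proof.
move=> aoo boo; apply: (@le_abs_summable _ (fun x => `|a x| + `|b x|)).
  by move=> x; rewrite ler_normD.
by rewrite tsumD// lte_add_pinfty.
Qed.

Lemma abs_summableZ c a : abs_summable a -> abs_summable (fun x => c * a x).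
Proof.
move=> aoo; apply: (@le_abs_summable _ (fun x => `|c| * `|a x|)).
  by move=> x; rewrite normrM.
by rewrite tsumZ// lte_mul_pinfty// ?lee_fin.
Qed.

Lemma rsumD a b : abs_summable a -> abs_summable b ->
  rsum (fun x => a x + b x) = rsum a + rsum b.
Proof.
move=> aoo boo.
have [aP aN] := (abs_summable_pos aoo, abs_summable_neg aoo).
have [bP bN] := (abs_summable_pos boo, abs_summable_neg boo).
rewrite (@rsum_diff _ (fun x => a^\+ x + b^\+ x) (fun x => a^\- x + b^\- x)).
- rewrite !tsumD ?funrpos_ge0 ?funrneg_ge0//.
  rewrite !fineD ?fin_tsum//; try exact: funrpos_ge0; try exact: funrneg_ge0.
  by rewrite !rsumE; lra.
- by move=> x; rewrite addr_ge0.
- by move=> x; rewrite addr_ge0.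
- by rewrite tsumD// lte_add_pinfty.
- by rewrite tsumD// lte_add_pinfty.
- by move=> x; rewrite (funr_pos_neg a) (funr_pos_neg b); lra.
Qed.

Lemma rsumZ c a : abs_summable a -> rsum (fun x => c * a x) = c * rsum a.
Proof.
move=> aoo; have [aP aN] := (abs_summable_pos aoo, abs_summable_neg aoo).
have fP := fin_tsum (funrpos_ge0 a) aP; have fN := fin_tsum (funrneg_ge0 a) aN.
have [c0|/ltW c0] := leP 0 c.
  by rewrite !rsumE ge0_funrposM// ge0_funrnegM// !tsumZ// !fineM//=; ring.
have Nc0 : 0 <= - c by rewrite oppr_ge0.
by rewrite !rsumE le0_funrposM// le0_funrnegM// !tsumZ// !fineM//=; ring.
Qed.

Lemma ler_rsum a b : (forall x, a x <= b x) -> abs_summable a ->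
  abs_summable b -> rsum a <= rsum b.
Proof.
move=> ab aoo boo; rewrite -subr_ge0 -mulN1r -rsumZ// -rsumD//; last first.
  exact: abs_summableZ.
have d0 x : 0 <= b x + -1 * a x by have := ab x; lra.
rewrite rsum_ge0E//; first by rewrite fine_ge0// tsum_ge0.
have := abs_summableD boo (abs_summableZ (-1) aoo).
by apply: le_lt_trans; apply: le_tsum => x; exact: ler_norm.
Qed.

Lemma tsum_delta (u : T) (y : R) : 0 <= y ->
  tsum (fun x => if x == u then y else 0) = y%:E.
Proof.
move=> y0; rewrite -(@esum_set1 _ _ u (fun=> y%:E)) ?lee_fin// esum_mkcond.
apply: eq_esum => x _; case: eqP => [->|xu]; first by rewrite mem_set.
by rewrite memNset// => /= xu'; exact: xu.
Qed.

Lemma rsum_delta (u : T) (y : R) : rsum (fun x => if x == u then y else 0) = y.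
Proof.
rewrite (@rsum_diff _ (fun x => if x == u then Num.max y 0 else 0)
                      (fun x => if x == u then Num.max (- y) 0 else 0)).
- have m0 z : 0 <= Num.max z 0 :> R by rewrite le_max lexx orbT.
  rewrite !tsum_delta//=; have := @funr_pos_neg (fun=> y) u.
  by rewrite /funrpos /funrneg => <-.
- by move=> x; case: ifP => // _; rewrite le_max lexx orbT.
- by move=> x; case: ifP => // _; rewrite le_max lexx orbT.
- by rewrite tsum_delta ?ltry// le_max lexx orbT.
- by rewrite tsum_delta ?ltry// le_max lexx orbT.
- move=> x; case: ifP => _; last by rewrite subrr.
  exact: (@funr_pos_neg (fun=> y) x).
Qed.

(** Cutting off by zero, rather than summing over a subtype, keeps all families
    indexed by [T], where linearity is available. *)
Definition on_fibre (G : zmodType) (par : T -> T) (u : T) (a : T -> G) : T -> G :=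
  fun v => if par v == u then a v else 0.

Lemma tsum_fibre par u a :
  tsum (on_fibre par u a) = \esum_(v in [set v | par v = u]) (a v)%:E.
Proof.
rewrite esum_mkcond; apply: eq_esum => v _; rewrite /on_fibre.
by case: eqP => [h|h]; [rewrite mem_set|rewrite memNset].
Qed.

(** The fibres of [par] partition [T]: the pairs [(u, v)] with [par v = u] are
    in bijection with [T] through their second component. *)
Lemma tsum_by_fibre par a : (forall x, 0 <= a x) ->
  tsum a = \esum_(u in [set: T]) tsum (on_fibre par u a).
Proof.
move=> a0; transitivity
    (\esum_(u in [set: T]) \esum_(v in [set v | par v = u]) (a v)%:E).
  rewrite (esum_esum (J := fun u => [set v | par v = u]))//.
  apply: (@reindex_esum _ _ _ _ setT snd (fun v => (a v)%:E)); split => //.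
    move=> [u v] [u' v'] /[!inE]/= -[_ uv] [_ uv'] vv'.
    by rewrite -uv -uv' vv'.
  by move=> v _; exists (par v, v).
  by move=> u v _ _; rewrite lee_fin.
by apply: eq_esum => u _; rewrite tsum_fibre.
Qed.

Lemma tsum_on_fibre_lty par u a : (forall x, 0 <= a x) -> (tsum a < +oo)%E ->
  (tsum (on_fibre par u a) < +oo)%E.
Proof.
by move=> a0; apply: le_lt_trans; apply: le_tsum => v; rewrite /on_fibre; case: ifP.
Qed.

(** Fubini for the fibration [par]: the two nonnegative parts are regrouped
    separately, and their fibre sums decompose the fibre sums of [a]. *)
Lemma rsum_by_fibre par a : abs_summable a ->
  rsum a = rsum (fun u => rsum (on_fibre par u a)).
Proof.
move=> aoo.
have fibsum p (p0 : forall x, 0 <= p x) (poo : (tsum p < +oo)%E) :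
    tsum p = tsum (fun u => fine (tsum (on_fibre par u p))).
  rewrite (tsum_by_fibre par)//; apply: eq_esum => u _; rewrite fineK//.
  apply: fin_tsum; last exact: tsum_on_fibre_lty.
  by move=> v; rewrite /on_fibre; case: ifP.
have fib0 p (p0 : forall x, 0 <= p x) u : 0 <= fine (tsum (on_fibre par u p)).
  by apply/fine_ge0/tsum_ge0 => v; rewrite /on_fibre; case: ifP.
have [aP aN] := (abs_summable_pos aoo, abs_summable_neg aoo).
rewrite rsumE (fibsum a^\+)// (fibsum a^\-)//; apply/esym/rsum_diff.
- exact: fib0.
- exact: fib0.
- by rewrite -fibsum.
- by rewrite -fibsum.
- move=> u; apply: rsum_diff.
  + by move=> v; rewrite /on_fibre; case: ifP.
  + by move=> v; rewrite /on_fibre; case: ifP.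
  + exact: tsum_on_fibre_lty.
  + exact: tsum_on_fibre_lty.
  + move=> v; rewrite /on_fibre; case: ifP => _; last by rewrite subrr.
    exact: funr_pos_neg.
Qed.

End real_sums.

(** * Complex moduli and unordered sums of complex families *)

Section complex_modulus.
Context (R : realType).
Implicit Types (x y z : R[i]).

Lemma normc_sqr z : normc z ^+ 2 = complex.Re z ^+ 2 + complex.Im z ^+ 2.
Proof. by case: z => p q; rewrite /= sqr_sqrtr// addr_ge0// sqr_ge0. Qed.

Lemma normc_ge0 z : 0 <= normc z.
Proof. by case: z => p q; exact: sqrtr_ge0. Qed.

Lemma normc_conj z : normc z^*%R = normc z.
Proof. by case: z => p q; rewrite /= sqrrN. Qed.

Lemma ler_Re_normc z : `|complex.Re z| <= normc z.
Proof.
by case: z => p q /=; rewrite -sqrtr_sqr ler_wsqrtr// lerDl sqr_ge0.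
Qed.

Lemma ler_Im_normc z : `|complex.Im z| <= normc z.
Proof.
by case: z => p q /=; rewrite -sqrtr_sqr ler_wsqrtr// lerDr sqr_ge0.
Qed.

Lemma Re_conj_mul z : complex.Re (z^* * z) = normc z ^+ 2.
Proof. by rewrite normc_sqr; case: z => p q /=; ring. Qed.

Lemma normc_sqr_lin c x y :
  normc (c * x + y) ^+ 2 <= 2 * normc c ^+ 2 * normc x ^+ 2 + 2 * normc y ^+ 2.
Proof.
have := le_normcD (c * x) y; rewrite normcM => le_cxy.
apply: (@le_trans _ _ ((normc c * normc x + normc y) ^+ 2)).
  by rewrite lerXn2r ?nnegrE ?addr_ge0 ?mulr_ge0 ?normc_ge0.
have := sqr_ge0 (normc c * normc x - normc y); lra.
Qed.

Lemma normc_mul_conj_le x y : normc (x * y^*) <= normc x ^+ 2 + normc y ^+ 2.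
Proof.
rewrite normcM normc_conj.
have := sqr_ge0 (normc x - normc y); have := sqr_ge0 (normc x + normc y); lra.
Qed.

End complex_modulus.

Section complex_sums.
Context (R : realType) (T : choiceType).
Implicit Types (a b : T -> R[i]) (c : R[i]).

Definition abs_csummable a := (tsum (fun x => normc (a x)) < +oo)%E.

Lemma abs_csummable_Re a :
  abs_csummable a -> abs_summable (fun x => complex.Re (a x)).
Proof. by apply: le_abs_summable => x; exact: ler_Re_normc. Qed.

Lemma abs_csummable_Im a :
  abs_csummable a -> abs_summable (fun x => complex.Im (a x)).
Proof. by apply: le_abs_summable => x; exact: ler_Im_normc. Qed.

Lemma csumZ c a : abs_csummable a -> csum (fun x => c * a x) = c * csum a.
Proof.
move=> aoo; have reoo := abs_csummable_Re aoo; have imoo := abs_csummable_Im aoo.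
case: c => c1 c2; rewrite /csum.
have -> : (fun x => complex.Re ((c1 +i* c2) * a x)) =
    (fun x => c1 * complex.Re (a x) + (- c2) * complex.Im (a x)).
  by apply/funext => x; case: (a x) => p q /=; ring.
have -> : (fun x => complex.Im ((c1 +i* c2) * a x)) =
    (fun x => c1 * complex.Im (a x) + c2 * complex.Re (a x)).
  by apply/funext => x; case: (a x) => p q /=; ring.
rewrite !rsumD ?rsumZ//; try exact: abs_summableZ.
by apply/eqP; rewrite eq_complex /= mulNr !eqxx.
Qed.

Lemma csum_delta (u : T) (y : R[i]) :
  csum (fun x => if x == u then y else 0) = y.
Proof.
case: y => p q; rewrite /csum.
by congr Complex; rewrite -[RHS](rsum_delta u); congr rsum; apply/funext => x;
  case: ifP.
Qed.

Lemma csum_by_fibre par a : abs_csummable a ->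
  csum a = csum (fun u => csum (on_fibre par u a)).
Proof.
move=> aoo; rewrite /csum (rsum_by_fibre par (abs_csummable_Re aoo)).
rewrite (rsum_by_fibre par (abs_csummable_Im aoo)).
congr Complex; congr rsum; apply/funext => u; congr rsum;
  by apply/funext => v; rewrite /on_fibre; case: ifP.
Qed.

Lemma ell2_mul_conj f g : @ell2 R T f -> ell2 g ->
  abs_csummable (fun x => f x * (g x)^*).
Proof.
move=> f2 g2; apply: (@le_lt_trans _ _
    (tsum (fun x => normc (f x) ^+ 2 + normc (g x) ^+ 2)%R)).
  by apply: le_tsum => x; exact: normc_mul_conj_le.
by rewrite tsumD ?lte_add_pinfty// => x; exact: sqr_ge0.
Qed.

(** Closure under linear combinations of the weighted spaces [L^2(k)]; the
    weight [k = 1] gives [ell2] and the squared norms of the shifted basis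
    vectors give the domain of a weighted shift. *)
Lemma weighted_sqsum_lin (k : T -> R) c f g : (forall x, 0 <= k x) ->
  (tsum (fun x => k x * normc (f x) ^+ 2)%R < +oo)%E ->
  (tsum (fun x => k x * normc (g x) ^+ 2)%R < +oo)%E ->
  (tsum (fun x => k x * normc (c * f x + g x) ^+ 2)%R < +oo)%E.
Proof.
move=> k0 foo goo.
have kn0 h x : 0 <= k x * normc (h x) ^+ 2 by rewrite mulr_ge0// sqr_ge0.
have c0 : 0 <= 2 * normc c ^+ 2 by rewrite mulr_ge0// sqr_ge0.
pose F x := (2 * normc c ^+ 2) * (k x * normc (f x) ^+ 2).
pose G x := 2 * (k x * normc (g x) ^+ 2).
apply: (@le_lt_trans _ _ (tsum (fun x => F x + G x)%R)).
  apply: le_tsum => x; have := ler_wpM2l (k0 x) (normc_sqr_lin c (f x) (g x)).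
  by rewrite /F /G; lra.
rewrite tsumD; last by move=> x; rewrite mulr_ge0.
  by rewrite !tsumZ// lte_add_pinfty// lte_mul_pinfty// lee_fin.
by move=> x; rewrite mulr_ge0.
Qed.

End complex_sums.

(** * Finitely supported approximation *)

Section ell2_tail.
Context (R : realType) (T : choiceType).
Implicit Types (f : T -> R[i]) (X : set T).

Definition restrict_to X f : T -> R[i] := fun x => if x \in X then f x else 0.

(** A finite partial sum of the squared norm within [e^2] of the total supplies
    the set, since the squared norm of the remainder is what is missing. *)
Lemma ell2_finite_approx f (e : R) : ell2 f -> 0 < e ->
  exists2 X : set T, finite_set X &
    ell2norm (fun x => f x - restrict_to X f x) < e.
Proof.
move=> f2 e0; pose a x := normc (f x) ^+ 2.
have a0 x : 0 <= a x by rewrite sqr_ge0.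
have fa : tsum a \is a fin_num by exact: fin_tsum.
have e20 : 0 < e ^+ 2 by rewrite exprn_gt0.
have [_ [X [finX _] <-] ltX] := ub_ereal_sup_adherent e20 fa.
exists X => //; pose r x := if x \in X then a x else 0.
have r0 x : 0 <= r x by rewrite /r; case: ifP.
pose d x := if x \in X then 0 else a x.
have d0 x : 0 <= d x by rewrite /d; case: ifP.
have splita : tsum a = (tsum r + tsum d)%E.
  rewrite -tsumD//; congr tsum; apply/funext => x; rewrite /r /d.
  by case: ifP; rewrite ?addr0 ?add0r.
have sumX : tsum r = (\sum_(x \in X) (a x)%:E)%E.
  rewrite -esum_fset//; last by move=> x _; rewrite lee_fin.
  by rewrite [RHS]esum_mkcond; apply: eq_esum => x _; rewrite /r; case: ifP.
have [fr fd] : tsum r \is a fin_num /\ tsum d \is a fin_num.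
  by move: fa; rewrite splita fin_numD => /andP.
have -> : ell2norm (fun x => f x - restrict_to X f x) = Num.sqrt (fine (tsum d)).
  congr (Num.sqrt (fine _)); apply: eq_esum => x _; rewrite /restrict_to /d.
  by case: ifP => _; rewrite ?subrr ?subr0// normc0 expr0n.
rewrite -(ger0_norm (ltW e0)) -sqrtr_sqr ltr_sqrt//.
move: ltX; rewrite -[ereal_sup _]/(tsum a) splita -sumX.
move: fr fd => /fineK<- /fineK<-; set x := fine (tsum r); set y := fine (tsum d).
move=> h; have {h} : x + y - e ^+ 2 < x by rewrite -lte_fin; exact: h.
by rewrite /=; lra.
Qed.

End ell2_tail.

(** * A sufficient condition for hyponormality on rootless trees *)

Section rootless_shift.
Context (R : realType) (T : choiceType) (E : T -> T -> Prop) (w : T -> R[i]).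
Context (pa : T -> T) (b : T -> R).
Context (childP : forall u v, E u v <-> pa v = u).
Context (b_gt0 : forall u, 0 < b u).
Context (bE : forall u, \esum_(v in Chi E u) (normc (w v) ^+ 2)%:E = (b u)%:E).
Context (ratio_le1 :
  forall u, (\esum_(v in Chi E u) (normc (w v) ^+ 2 / b v)%:E <= 1)%E).
Implicit Types (f g h : T -> R[i]).

Let S := weighted_shift E w.
Let energy f : T -> R := fun u => b u * normc (f u) ^+ 2.

Lemma ChiE u : Chi E u = [set v | pa v = u].
Proof. by apply/seteqP; split=> v /= /childP. Qed.

Lemma par_shift v : par E v = pa v.
Proof.
apply: xget_subset1; first exact/childP.
by move=> u u' /= /childP <- /childP <-.
Qed.

Lemma fibre_weight u : tsum (on_fibre pa u (fun v => normc (w v) ^+ 2)) = (b u)%:E.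
Proof. by rewrite tsum_fibre -ChiE. Qed.

Lemma fibre_ratio u :
  (tsum (on_fibre pa u (fun v => normc (w v) ^+ 2 / b v)%R) <= 1)%E.
Proof. by rewrite tsum_fibre -ChiE. Qed.

Lemma energy_ge0 f u : 0 <= energy f u.
Proof. by rewrite mulr_ge0 ?sqr_ge0// ltW. Qed.

Lemma dom_shiftE f : dom S f = (ell2 f /\ (tsum (energy f) < +oo)%E).
Proof.
congr (_ /\ (_ < _)%E); apply: eq_esum => u _; by rewrite bE -EFinM.
Qed.

Lemma sqsum_shift f : sqsum (S f) = tsum (energy f).
Proof.
have n0 z : 0 <= normc z ^+ 2 :> R by exact: sqr_ge0.
rewrite -[LHS]/(tsum _) (tsum_by_fibre pa)//; apply: eq_esum => u _.
rewrite /energy EFinM -fibre_weight muleC -tsumZ//; last first.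
  by move=> v; rewrite /on_fibre; case: ifP.
congr tsum; apply/funext => v; rewrite /on_fibre /=.
by case: eqP => [<-|_]; rewrite ?mulr0// par_shift normcM exprMn mulrC.
Qed.

Lemma shift_linear : linear_operator S.
Proof.
have ell2E f : ell2 f = (tsum (fun x => 1 * normc (f x) ^+ 2)%R < +oo)%E :> Prop.
  by congr (is_true (_ < _)%E); apply: eq_esum => x _; rewrite mul1r.
split.
- by move=> f; rewrite dom_shiftE => -[].
- by rewrite dom_shiftE /ell2/= /sqsum /tsum !esum1// => x _;
    rewrite /energy normc0 expr0n/= ?mulr0.
- move=> c f g; rewrite !dom_shiftE !ell2E => -[f2 foo] [g2 goo]; split.
    exact: (@weighted_sqsum_lin _ _ (fun=> 1)).
  by apply: weighted_sqsum_lin => // u; exact: ltW.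
- by move=> f; rewrite dom_shiftE => -[_]; rewrite /ell2/= sqsum_shift.
- by move=> c f g _ _; apply/funext => v /=; ring.
Qed.

Lemma dom_shift_finite X f : finite_set X -> dom S (restrict_to X f).
Proof.
move=> finX; pose z := restrict_to X f.
have fin_sup (k : T -> R) : (forall x, 0 <= k x) ->
    (tsum (fun x => k x * normc (z x) ^+ 2)%R < +oo)%E.
  move=> k0; pose a x := k x * normc (f x) ^+ 2.
  have a0 x : 0 <= a x by rewrite mulr_ge0// sqr_ge0.
  have -> : tsum (fun x => k x * normc (z x) ^+ 2)%R = \esum_(x in X) (a x)%:E.
    rewrite esum_mkcond; apply: eq_esum => x _; rewrite /z /restrict_to /a.
    by case: ifP => //; rewrite normc0 expr0n mulr0.
  rewrite esum_fset//; last by move=> x _; rewrite lee_fin.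
  by rewrite fsumEFin// ltry.
rewrite dom_shiftE; split; last by apply: fin_sup => u; exact: ltW.
have := fin_sup (fun=> 1) (fun=> ler01).
by rewrite /ell2/=; congr (_ < _)%E; apply: eq_esum => x _; rewrite mul1r.
Qed.

Lemma shift_densely_defined : densely_defined S.
Proof.
move=> f f2 e e0; have [X finX ltX] := ell2_finite_approx f2 e0.
by exists (restrict_to X f) => //; exact: dom_shift_finite.
Qed.

(** The conjugate is outside the sum so that pairing with this vector produces
    the family sum itself, with no rule for conjugating sums. *)
Definition shift_adjoint f : T -> R[i] :=
  fun u => (csum (on_fibre pa u (fun v => w v * (f v)^*)))^*%R.

Lemma fibre_pairing_summable f u : ell2 f ->
  abs_csummable (on_fibre pa u (fun v => w v * (f v)^*)).
Proof.
move=> f2; pose p v := on_fibre pa u (fun v => normc (w v) ^+ 2) v.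
have p0 v : 0 <= p v by rewrite /p /on_fibre; case: ifP => // _; exact: sqr_ge0.
apply: (@le_lt_trans _ _ (tsum (fun v => p v + normc (f v) ^+ 2)%R)).
  apply: le_tsum => v; rewrite /p /on_fibre; case: ifP => _.
    exact: normc_mul_conj_le.
  by rewrite normc0 add0r sqr_ge0.
rewrite tsumD//; last by move=> v; exact: sqr_ge0.
by rewrite lte_add_pinfty// fibre_weight ltry.
Qed.

(** Cauchy-Schwarz in one sibling family, weighted by [b].  Let [h] be the family
    sum of [w v * conj (f v)].  Completing the square gives, for each child [v],
    [2 Re (conj h * w v * conj (f v)) <= |h|^2 (|w v|^2 / b v) + b v |f v|^2].
    Summing over the family, the left side becomes [2 |h|^2] and the first term
    on the right is at most [|h|^2]. *)
Lemma shift_adjoint_le f u : dom S f ->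
  normc (shift_adjoint f u) ^+ 2 <= fine (tsum (on_fibre pa u (energy f))).
Proof.
rewrite dom_shiftE => -[f2 foo]; rewrite normc_conj.
set a := on_fibre pa u _; set h := csum a.
have aoo : abs_csummable a by exact: fibre_pairing_summable.
set B := on_fibre pa u (energy f).
pose r v := on_fibre pa u (fun v => normc (w v) ^+ 2 / b v) v.
have B0 v : 0 <= B v by rewrite /B /on_fibre; case: ifP => // _; exact: energy_ge0.
have r0 v : 0 <= r v.
  by rewrite /r /on_fibre; case: ifP => // _; rewrite divr_ge0 ?sqr_ge0// ltW.
have Boo : (tsum B < +oo)%E.
  by apply: tsum_on_fibre_lty => // v; exact: energy_ge0.
have roo : (tsum r < +oo)%E by rewrite (le_lt_trans (fibre_ratio u))// ltry.
have hh0 : 0 <= normc h ^+ 2 by exact: sqr_ge0.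
have rr1 : fine (tsum r) <= 1.
  by rewrite -lee_fin fineK ?fin_tsum//; exact: fibre_ratio.
pose c := normc h ^+ 2.
have croo : (tsum (fun v => c * r v)%R < +oo)%E.
  by rewrite tsumZ// lte_mul_pinfty// lee_fin.
have cr0 v : 0 <= c * r v by rewrite mulr_ge0.
have hE : normc h ^+ 2 = rsum (fun v => complex.Re (h^* * a v)).
  rewrite -Re_conj_mul {2}/h -csumZ//.
have zaoo : abs_csummable (fun v => h^* * a v).
  apply: (@le_lt_trans _ _ (tsum (fun v => normc h * normc (a v))%R)).
    by apply: le_tsum => v; rewrite normcM normc_conj.
  rewrite tsumZ ?normc_ge0//; last by move=> v; exact: normc_ge0.
  by rewrite lte_mul_pinfty// lee_fin normc_ge0.
have le2 : 2 * normc h ^+ 2 <= rsum (fun v => c * r v + B v).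
  rewrite hE -rsumZ; last exact: abs_csummable_Re.
  apply: ler_rsum.
  - move=> v; rewrite /c /r /B /a /on_fibre; case: ifP => _; last first.
      by rewrite !mulr0 /= ?mulr0 ?addr0.
    rewrite /energy; set p := w v * _.
    have lep : complex.Re (h^* * p) <= normc h * normc (w v) * normc (f v).
      apply: (le_trans (ler_norm _)); apply: (le_trans (ler_Re_normc _)).
      by rewrite !normcM !normc_conj mulrA.
    have bv := b_gt0 v.
    have : 0 <= (normc h * normc (w v) - b v * normc (f v)) ^+ 2 / b v.
      by rewrite divr_ge0 ?sqr_ge0// ltW.
    have -> : (normc h * normc (w v) - b v * normc (f v)) ^+ 2 / b v =
        normc h ^+ 2 * (normc (w v) ^+ 2 / b v) + b v * normc (f v) ^+ 2 -
        2 * (normc h * normc (w v) * normc (f v)).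
      by field; rewrite gt_eqF.
    by lra.
  - exact/abs_summableZ/abs_csummable_Re.
  - apply: (@le_abs_summable _ _ _ (fun v => c * r v + B v)).
      by move=> v; rewrite ger0_norm// addr_ge0.
    by rewrite tsumD// lte_add_pinfty.
move: le2; rewrite rsum_ge0E; last first.
- by rewrite tsumD// lte_add_pinfty.
- by move=> v; rewrite addr_ge0.
rewrite tsumD// fineD ?fin_tsum// tsumZ// fineM ?fin_tsum// -[fine c%:E]/c.
by have := ler_wpM2l hh0 rr1; rewrite /c; lra.
Qed.

Lemma sqsum_shift_adjoint f : dom S f ->
  (sqsum (shift_adjoint f) <= sqsum (S f))%E.
Proof.
move=> Sf; have := Sf; rewrite dom_shiftE => -[_ foo].
rewrite sqsum_shift (tsum_by_fibre pa (energy_ge0 f)); apply: le_esum => u _.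
rewrite -[leRHS]fineK ?lee_fin ?shift_adjoint_le//.
apply: fin_tsum; last by apply: tsum_on_fibre_lty => // v; exact: energy_ge0.
by move=> v; rewrite /on_fibre; case: ifP => // _; exact: energy_ge0.
Qed.

Lemma ell2_shift f : dom S f -> ell2 (S f).
Proof. by have [_ _ _ + _] := shift_linear; exact. Qed.

(** On the family of children of [u] the factor [g (par v)] is the constant
    [g u] and leaves the inner sum. *)
Lemma ell2dot_shift f g : ell2 f -> dom S g ->
  ell2dot (S g) f = ell2dot g (shift_adjoint f).
Proof.
move=> f2 Sg; have S2 := ell2_shift Sg.
rewrite /ell2dot (csum_by_fibre pa (ell2_mul_conj S2 f2)).
congr csum; apply/funext => u; rewrite /shift_adjoint conjCK -csumZ; last first.
  exact: fibre_pairing_summable.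
congr csum; apply/funext => v; rewrite /on_fibre /=.
by case: eqP => [<-|_]; rewrite ?mulr0// par_shift; ring.
Qed.

Lemma shift_adjoint_value f : dom S f -> adjoint_value S f (shift_adjoint f).
Proof.
move=> Sf; split.
  exact: le_lt_trans (sqsum_shift_adjoint Sf) (ell2_shift Sf).
by move=> g; apply: ell2dot_shift; move: Sf; rewrite dom_shiftE => -[].
Qed.

(** Pairing with the basis vector at [u], which lies in the domain, recovers the
    coordinate at [u] of any adjoint value. *)
Lemma adjoint_value_unique f h h' :
  adjoint_value S f h -> adjoint_value S f h' -> h = h'.
Proof.
move=> [_ fh] [_ fh']; apply/funext => u.
pose e := restrict_to [set u] (fun=> 1 : R[i]).
have Se : dom S e by apply: dom_shift_finite.
have dote k : ell2dot e k = (k u)^*%R.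
  rewrite -[RHS](csum_delta u); congr csum; apply/funext => x.
  rewrite /e /restrict_to; case: eqP => [->|xu].
    by rewrite mem_set// mul1r.
  by rewrite memNset// mul0r.
by rewrite -[h u]conjCK -dote -fh// fh'// dote conjCK.
Qed.

Lemma adjoint_shift f : dom S f -> adjoint S f = shift_adjoint f.
Proof.
move=> Sf; apply: xget_subset1; first exact: shift_adjoint_value.
by move=> h h'; exact: adjoint_value_unique.
Qed.

(** This sufficient condition is classical for weighted shifts on directed
    trees; here [b u] is the squared norm of the image of the basis vector at
    [u]. *)
Theorem shift_hyponormal : hyponormal S.
Proof.
split; [exact: shift_linear|exact: shift_densely_defined| |].
- move=> f Sf; split; last by exists (shift_adjoint f); exact: shift_adjoint_value.
  by move: Sf; rewrite dom_shiftE => -[].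
- move=> f Sf; rewrite adjoint_shift//; apply: ler_wsqrtr.
  have n0 z : 0 <= normc z ^+ 2 :> R by exact: sqr_ge0.
  have le := sqsum_shift_adjoint Sf; have S2 := ell2_shift Sf.
  by apply: fine_le; rewrite ?fin_tsum// (le_lt_trans le).
Qed.

End rootless_shift.

(** * Extrema of sets of integers in the extended integers *)

Section integer_extrema.
Implicit Types (A : set int) (k n : int).

Lemma infimum_min A k : A k -> (forall n, A n -> k <= n) ->
  infimum +oo%E [set n%:E%E | n in A] = k%:E.
Proof.
move=> Ak minA; rewrite /infimum ifF; last first.
  by apply/negbTE/set0P; exists k%:E, k.
apply: xget_subset1; last exact: is_subset1_infimums.
split; first by move=> _ [n An <-]; rewrite lee_fin minA.
by move=> x; apply; exists k.
Qed.

Lemma infimum_unbounded A : ~ (exists k, forall n, A n -> k <= n) ->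
  infimum +oo%E [set n%:E%E | n in A] = -oo%E.
Proof.
move=> unb; rewrite /infimum; case: ifPn => [/eqP A0|_].
  exfalso; apply: unb; exists 0 => n An.
  have : [set n%:E%E | n in A] n%:E by exists n.
  by rewrite A0.
apply: xget_subset1; last exact: is_subset1_infimums.
split; first by move=> ? _; exact: leNye.
move=> x; case: x => [k||] lbk //.
  exfalso; apply: unb; exists k => n An.
  by rewrite -lee_fin; apply: lbk; exists n.
exfalso; apply: unb; exists 0 => n An.
by have := lbk _ (ex_intro2 _ _ n An erefl).
Qed.

Lemma supremum_max A k : A k -> (forall n, A n -> n <= k) ->
  supremum -oo%E [set n%:E%E | n in A] = k%:E.
Proof.
move=> Ak maxA; rewrite /supremum ifF; last first.
  by apply/negbTE/set0P; exists k%:E, k.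
apply: xget_subset1; last exact: is_subset1_supremums.
split; first by move=> _ [n An <-]; rewrite lee_fin maxA.
by move=> x; apply; exists k.
Qed.

Lemma supremum_unbounded A : ~ (exists k, forall n, A n -> n <= k) ->
  supremum -oo%E [set n%:E%E | n in A] = +oo%E.
Proof.
move=> unb; rewrite /supremum; case: ifPn => [/eqP A0|_].
  exfalso; apply: unb; exists 0 => n An.
  have : [set n%:E%E | n in A] n%:E by exists n.
  by rewrite A0.
apply: xget_subset1; last exact: is_subset1_supremums.
split; first by move=> ? _; exact: leey.
move=> x; case: x => [k||] ubk //.
  exfalso; apply: unb; exists k => n An.
  by rewrite -lee_fin; apply: ubk; exists n.
exfalso; apply: unb; exists 0 => n An.
by have := ubk _ (ex_intro2 _ _ n An erefl).
Qed.

Lemma int_bounded_has_max A k : A !=set0 -> (forall n, A n -> n <= k) ->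
  exists2 N, A N & forall n, A n -> n <= N.
Proof.
move=> [n0 An0] ubk; have [||N [AN minN]] :=
    @int_lbound_has_minimum [set n | A (- n)] (- k).
- by exists (- n0); rewrite /= opprK.
- by move=> n /= /ubk; rewrite lerNl.
- exists (- N) => // n An; rewrite lerNr; apply: minN.
  by rewrite /= opprK.
Qed.

Lemma finite_int_interval a b : finite_set [set n : int | a <= n <= b].
Proof.
apply: (@sub_finite_set _ _ ((fun i : nat => a + i%:Z) @` `I_(`|b - a|.+1))).
  move=> n /= /andP[an nb]; exists `|n - a|%N; lia.
exact/finite_image/finite_II.
Qed.

End integer_extrema.

(** * The tree of sequences *)

Section vertices.
Implicit Types (s : int -> int) (u v : V) (n N L : int).

(** Explicit integers replace the supremum and the infimum in the definition of
    [V].  The bound [L] is not determined by [s], so that it can be chosen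
    small enough for several sequences at once. *)
Definition profile s N L :=
  [/\ forall n, n <= N -> 0 <= s n, forall n, N < n -> s n = -1
    & forall n, n < L -> s n = 0].

Lemma profile_M s N L : profile s N L -> M s = N%:E.
Proof.
move=> [s0 s1 _]; apply: supremum_max => /= [|n sn].
  by have := s0 N (lexx N); lia.
by rewrite leNgt; apply/negP => /s1 sn1; move: sn; rewrite sn1.
Qed.

(** The set of indices of nonzero entries contains [N + 1], where the entry is
    [-1], so its infimum is attained at some [k <= N + 1]. *)
Lemma profile_m s N L : profile s N L ->
  exists2 k, m s = (k - 2)%:E & k <= N + 1 /\ forall n, n < k -> s n = 0.
Proof.
move=> [s0 s1 sL]; have sN1 : s (N + 1) != 0 by rewrite s1//; lia.
have [||k [sk mink]] := @int_lbound_has_minimum [set n | s n != 0] L.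
- by exists (N + 1).
- by move=> n /= sn; rewrite leNgt; apply/negP => /sL sn0; rewrite sn0 in sn.
exists k; first by rewrite /m (infimum_min sk).
split; first exact: mink.
by move=> n nk; apply/eqP/negPn/negP => /mink; rewrite leNgt nk.
Qed.

Lemma profile_admissible s N L : profile s N L -> admissible s.
Proof.
move=> sP; have [k mE _] := profile_m sP; have ME := profile_M sP.
move: sP => [s0 s1 _]; split.
- by move=> n; have [/s0|/s1] := leP n N; lia.
- by rewrite mE ltNyr.
- by rewrite ME ltry.
- by move=> n; rewrite ME lee_fin => /s0; lia.
Qed.

(** If the nonzero entries were unbounded below then [m s] would be [-oo], and if
    the entries above [-1] were unbounded above then [M s] would be [+oo].  The
    entries vanish far to the left, so some entry is above [-1] and the supremum
    is attained. *)
Lemma admissible_profile s : admissible s -> exists N L, profile s N L.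
Proof.
move=> [s_ge ms Ms s_gt].
have [L sL] : exists L, forall n, s n != 0 -> L <= n.
  by apply: contrapT => /infimum_unbounded sinf; move: ms; rewrite /m sinf.
have [k sk] : exists k, forall n, -1 < s n -> n <= k.
  by apply: contrapT => /supremum_unbounded ssup; move: Ms; rewrite /M ssup.
have s0 n : n < L -> s n = 0.
  by move=> nL; apply/eqP/negPn/negP => /sL; rewrite leNgt nL.
have [|N sN maxN] := @int_bounded_has_max [set n | -1 < s n] k _ sk.
  by exists (L - 1) => /=; rewrite s0//; lia.
have ME : M s = N%:E by exact: supremum_max.
exists N, L; split=> // [n nN|n Nn].
  by have := s_gt n; rewrite ME lee_fin => /(_ nN); lia.
have := s_ge n; have [//|] := boolP (-1 < s n); last by lia.
by move=> /maxN; lia.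
Qed.

Definition top v : int := fine (M (seq_of v)).

Lemma vertex_profile v : exists L, profile (seq_of v) (top v) L.
Proof.
have [N [L vP]] := admissible_profile (set_valP v).
by exists L; rewrite /top (profile_M vP).
Qed.

Lemma M_top v : M (seq_of v) = (top v)%:E.
Proof. by have [L /profile_M] := vertex_profile v. Qed.

Definition vertex_of s N L (sP : profile s N L) : V :=
  exist _ s (mem_set (profile_admissible sP)).

Lemma top_vertex_of s N L (sP : profile s N L) : top (vertex_of sP) = N.
Proof. by rewrite /top (profile_M sP). Qed.

Lemma vertex_eq u v : (forall n, seq_of u n = seq_of v n) -> u = v.
Proof. by move=> uv; apply: val_inj; apply/funext. Qed.

Lemma edgeP u v :
  E u v <-> top v = top u + 1 /\ forall n, n <= top u -> seq_of u n = seq_of v n.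
Proof.
rewrite /E !M_top; split => [[[tE] uv]|[tE uv]].
  by split=> // n nu; apply: uv; rewrite lee_fin.
by split=> [|n]; rewrite ?tE// lee_fin; exact: uv.
Qed.

Definition cut s N : int -> int := fun n => if n < N then s n else -1.

Lemma cut_profile v : exists L, profile (cut (seq_of v) (top v)) (top v - 1) L.
Proof.
have [L [v0 v1 vL]] := vertex_profile v.
(* the minimum keeps the vanishing range away from the entries set to [-1] *)
exists (Num.min L (top v)); split=> n; rewrite /cut.
- by move=> nt; rewrite ifT ?v0//; lia.
- by move=> nt; rewrite ifF//; lia.
- by rewrite lt_min => /andP[/vL -> ->].
Qed.

Definition parent v : V := vertex_of (projT2 (cid (cut_profile v))).

Lemma seq_parent v n :
  seq_of (parent v) n = if n < top v then seq_of v n else -1.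
Proof. by []. Qed.

Lemma top_parent v : top (parent v) = top v - 1.
Proof. exact: top_vertex_of. Qed.

Lemma edge_parent u v : E u v <-> parent v = u.
Proof.
rewrite edgeP; split=> [[tE uv]|<-]; last first.
  rewrite top_parent; split=> [|n nt]; first by rewrite subrK.
  by rewrite seq_parent ifT//; lia.
apply: vertex_eq => n; rewrite seq_parent.
case: ifPn => nt; first by rewrite -uv//; lia.
by have [L [_ u1 _]] := vertex_profile u; rewrite u1//; lia.
Qed.

Definition extend s N (k : nat) : int -> int :=
  fun n => if n <= N then s n else if n == N + 1 then k%:Z else -1.

Lemma extend_profile u k :
  exists L, profile (extend (seq_of u) (top u) k) (top u + 1) L.
Proof.
have [L [u0 u1 uL]] := vertex_profile u.
exists (Num.min L (top u)); split=> n; rewrite /extend.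
- by move=> nt; case: ifPn => [/u0//|ntu]; rewrite ifT//; lia.
- by move=> nt; rewrite !ifF//; lia.
- by rewrite lt_min => /andP[/uL h nt]; rewrite ifT// ltW.
Qed.

Definition child u k : V := vertex_of (projT2 (cid (extend_profile u k))).

Lemma seq_child u k n : seq_of (child u k) n =
  if n <= top u then seq_of u n else if n == top u + 1 then k%:Z else -1.
Proof. by []. Qed.

Lemma top_child u k : top (child u k) = top u + 1.
Proof. exact: top_vertex_of. Qed.

Lemma seq_child_top u k : seq_of (child u k) (top u + 1) = k%:Z.
Proof. by rewrite seq_child eqxx ifF//; lia. Qed.

Lemma children_bij u : set_bij [set: nat] (Chi E u) (child u).
Proof.
split.
- move=> k _ /=; apply/edgeP; rewrite top_child; split=> // n nt.
  by rewrite seq_child nt.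
- move=> k k' _ _ /(congr1 (fun v => seq_of v (top u + 1))).
  by rewrite !seq_child_top => -[].
- move=> v /= /edgeP[tE uv]; have [L [v0 v1 _]] := vertex_profile v.
  exists `|seq_of v (top u + 1)|%N => //; apply: vertex_eq => n.
  rewrite seq_child; case: ifPn => nt; first exact: uv.
  case: eqP => [->|ne]; last by rewrite v1//; lia.
  by have := v0 (top u + 1); rewrite tE lexx => /(_ isT); lia.
Qed.

Definition total u : int := \sum_(n \in [set n | n <= top u]) seq_of u n.

(** The infinite range in [total] is replaced by a finite one, on which terms can
    be split off. *)
Lemma total_interval u L : (forall n, n < L -> seq_of u n = 0) ->
  total u = \sum_(n \in [set n | L <= n <= top u]) seq_of u n.
Proof.
move=> uL; rewrite /total; apply/esym/fsbig_widen.
  by move=> n /= /andP[].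
by move=> n /= [nt /negP]; rewrite nt andbT -ltNge => /uL.
Qed.

Lemma total_child u k : total (child u k) = total u + k%:Z.
Proof.
have [L0 [_ _ uL0]] := vertex_profile u.
pose L := Num.min L0 (top u).
have uL n : n < L -> seq_of u n = 0 by rewrite lt_min => /andP[/uL0].
have Lt : L <= top u by rewrite ge_min lexx orbT.
have cL n : n < L -> seq_of (child u k) n = 0.
  by move=> nL; rewrite seq_child ifT ?uL//; lia.
rewrite (total_interval cL) (total_interval uL) top_child.
rewrite (@fsbigD1 _ _ _ _ (top u + 1)) /=; last 2 first.
- exact: finite_int_interval.
- lia.
rewrite seq_child_top addrC; congr (_ + _).
have -> : [set n | L <= n <= top u + 1] `\ (top u + 1) =
    [set n | L <= n <= top u].
  apply/seteqP; split=> n /=; first by move=> [? /eqP ?]; lia.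
  by move=> ?; split; [|apply/eqP]; lia.
by apply: eq_fsbigr => n /[!inE]/= /andP[_ nt]; rewrite seq_child nt.
Qed.

(** Only zero entries separate the range [m v <= n <= M v - 1] of the exponent
    from the range [n <= top u] of [total u], although [m v] may differ from
    [m u]. *)
Lemma weight_child (R : realType) u k :
  weight R (child u k) = ((2 : R) ^ total u / k.+1%:R)%:C.
Proof.
have [L cP] := vertex_profile (child u k).
have [k0 mE [k0t below]] := profile_m cP; have [_ _ uL] := cP.
rewrite /weight -[fine _]/(top (child u k)) M_top top_child seq_child_top mE.
have -> : \sum_(n \in [set n : int |
      ((k0 - 2)%:E <= n%:E <= (top u + 1)%:E - 1%:E)%E]) seq_of (child u k) n =
    total u.
  rewrite top_child in k0t.
  transitivity (\sum_(n \in [set n | n <= top u]) seq_of (child u k) n).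
    apply: fsbig_widen => n /=; rewrite -EFinB addrK !lee_fin.
      by move=> /andP[].
    by move=> [nt /negP]; rewrite nt andbT => nk; apply: below; lia.
  by apply: eq_fsbigr => n /[!inE]/= nt; rewrite seq_child nt.
have -> : (k%:Z + 1)%:~R = (k.+1%:R : R)%:C by rewrite -PoszD addn1 rmorph_nat.
rewrite rmorphM/= fmorphV; congr (_ / _).
by rewrite fmorphXz rmorph_nat.
Qed.

Lemma normc_weight_child (R : realType) u k :
  normc (weight R (child u k)) ^+ 2 =
  ((2 : R) ^ total u) ^+ 2 * (k.+1%:R ^+ 2)^-1.
Proof.
by rewrite weight_child normc_sqr /= expr0n addr0 exprMn exprVn.
Qed.

End vertices.

(** * The sum of the inverse squares *)

Section inverse_squares.
Context (R : realType).

Let inv_sq (k : nat) : R := (k.+1%:R ^+ 2)^-1.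

Lemma inv_sq_ge0 k : 0 <= inv_sq k.
Proof. by rewrite invr_ge0 sqr_ge0. Qed.

(** The bound telescopes: [1/(k+1)^2 <= 2/((k+1)(k+2)) = 2/(k+1) - 2/(k+2)]. *)
Lemma sum_inv_sq_le n : \sum_(0 <= k < n) inv_sq k <= 2 - 2 / n.+1%:R.
Proof.
elim: n => [|n ih]; first by rewrite big_nil divr1 subrr.
rewrite big_nat_recr//=; apply: (le_trans (lerD ih (lexx _))).
rewrite /inv_sq -(natr1 n.+1); set x : R := n.+1%:R.
have x1 : 1 <= x by rewrite ler1n.
(* here [x = n + 1], so [x - 1 >= 0] *)
have -> : 2 - 2 / x + (x ^+ 2)^-1 =
    2 - 2 / (x + 1) - (x - 1) / (x ^+ 2 * (x + 1)).
  by field; apply/andP; split; rewrite gt_eqF//; lra.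
rewrite lerBlDr lerDl divr_ge0//; first by lra.
by rewrite mulr_ge0 ?sqr_ge0//; lra.
Qed.

Lemma tsum_inv_sq_lty : (tsum inv_sq < +oo)%E.
Proof.
have e0 n : (0 <= (inv_sq n)%:E)%E by rewrite lee_fin inv_sq_ge0.
rewrite /tsum -nneseries_esumT//; apply: (@le_lt_trans _ _ 2%:E); last exact: ltry.
apply: lime_le; first exact: is_cvg_nneseries.
apply: nearW => n; rewrite sumEFin lee_fin.
apply: (le_trans (sum_inv_sq_le n)); rewrite lerBlDr lerDl.
by rewrite divr_ge0.
Qed.

Definition zeta2 : R := fine (tsum inv_sq).

Lemma tsum_inv_sq : tsum inv_sq = zeta2%:E.
Proof. by rewrite fineK// fin_tsum ?tsum_inv_sq_lty//; exact: inv_sq_ge0. Qed.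

Lemma zeta2_gt0 : 0 < zeta2.
Proof.
rewrite -lte_fin -tsum_inv_sq.
apply: (@lt_le_trans _ _ (tsum (fun k : nat => if k == 0%N then 1 else 0 : R)%R)).
  by rewrite tsum_delta ?ler01// lte_fin ltr01.
apply: le_tsum => k; case: eqP => [->|_]; last exact: inv_sq_ge0.
by rewrite /inv_sq expr1n invr1.
Qed.

End inverse_squares.

(** * The weighted shift on the tree of sequences *)

Section shift_on_sequences.
Context (R : realType).
Implicit Types (u v : V).

Lemma esum_children u (F : V -> R) :
  \esum_(v in Chi E u) (F v)%:E = tsum (fun k => F (child u k)).
Proof. exact: reindex_esum (children_bij u). Qed.

Definition shift_sqnorm u : R := ((2 : R) ^ total u) ^+ 2 * zeta2 R.

Lemma shift_sqnorm_gt0 u : 0 < shift_sqnorm u.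
Proof. by rewrite mulr_gt0 ?zeta2_gt0// exprn_gt0// exprz_gt0. Qed.

Lemma shift_sqnormE u :
  \esum_(v in Chi E u) (normc (weight R v) ^+ 2)%:E = (shift_sqnorm u)%:E.
Proof.
rewrite (esum_children u (fun v => normc (weight R v) ^+ 2)).
under eq_fun do rewrite normc_weight_child.
rewrite tsumZ ?sqr_ge0//.
by rewrite tsum_inv_sq -EFinM.
Qed.

(** At the [k]-th child the ratio is [4 ^ (- k) / ((k + 1)^2 zeta2)].  Bounding
    [4 ^ (- k)] by [1] is enough: what remains sums to exactly [1]. *)
Lemma shift_sqnorm_ratio u :
  (\esum_(v in Chi E u) (normc (weight R v) ^+ 2 / shift_sqnorm v)%:E <= 1)%E.
Proof.
rewrite (esum_children u (fun v => normc (weight R v) ^+ 2 / shift_sqnorm v)).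
apply: (@le_trans _ _ (tsum (fun k => (zeta2 R)^-1 * (k.+1%:R ^+ 2)^-1)%R)).
  apply: le_tsum => k; rewrite normc_weight_child /shift_sqnorm total_child.
  rewrite expfzDr// exprMn -exprnP.
  have := exprn_gt0 2 (exprz_gt0 (total u) (ltr0n R 2)).
  have := zeta2_gt0 R; set z := zeta2 R; set s := (2 ^ total u) ^+ 2 => z0 s0.
  set q : R := (k.+1%:R ^+ 2)^-1; have q0 : 0 <= q by exact: inv_sq_ge0.
  set t : R := (2 ^+ k) ^+ 2.
  have t1 : 1 <= t by rewrite !exprn_ege1// ler1n.
  have -> : s * q / (s * t * z) = z^-1 * q / t.
    by field; rewrite !gt_eqF//; lra.
  by rewrite ler_pdivrMr; [rewrite ler_peMr// mulr_ge0// invr_ge0 ltW|lra].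
have z0 : 0 <= (zeta2 R)^-1 by rewrite invr_ge0 ltW// zeta2_gt0.
by rewrite tsumZ// tsum_inv_sq -EFinM mulVf// gt_eqF// zeta2_gt0.
Qed.

End shift_on_sequences.

Theorem proposition6p2 (R : realType) :
  hyponormal (weighted_shift E (weight R)).
Proof.
apply: (shift_hyponormal edge_parent (@shift_sqnorm_gt0 R)).
- exact: shift_sqnormE.
- exact: shift_sqnorm_ratio.
Qed.
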